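(* Let $\mathbb{K}$ be a field of characteristic zero, $H$ a graded connected commutative Hopf algebra, and $A$ a commutative unital algebra with a splitting $A=A_+\oplus A_-$ into subalgebras with $1\in A_+$; let $R:A\to A$ be the projector onto $A_-$ with kernel $A_+$ and $\mathcal{R}(f):=R\circ f$ on $\mathrm{Lin}(H,A)$, so that $(\mathrm{Lin}(H,A),\mathcal{R})$ with convolution product $\star$ is a Rota--Baxter algebra of weight $\theta=-1$. Let $\gamma:H\to A$ be a unital algebra map, let $\gamma=\gamma_-^{-1}\star\gamma_+$ be its Bogoliubov decomposition, and let $a:=e_A-\gamma$. Then $$\gamma_-=e_A+\sum_{n>0}(\mathcal{R}a)^{[n]}=e_A+\sum_{n>0}\ \sum_{\substack{i_1+\cdots+i_k=n\\ i_1,\dots,i_k>0}}\frac{\mathfrak{L}_{-1}^{(i_1)}(a)\star\cdots\star\mathfrak{L}_{-1}^{(i_k)}(a)}{i_1(i_1+i_2)\cdots(i_1+\cdots+i_k)}.$$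
   Context: $\mathrm{Lin}(H,A)$ is the space of linear maps with convolution product $(f\star g)(h)=f(h^{(1)})g(h^{(2)})$ (Sweedler notation) and unit $e_A:=\eta_A\circ\varepsilon$ ($\varepsilon$ the counit of $H$, $\eta_A$ the unit map of $A$). Infinite sums are understood pointwise on $H$ (they are finite on each element of $H$ since $a$ vanishes on $H_0$). Bogoliubov decomposition: every algebra map $\gamma:H\to A$ factors uniquely as $\gamma=\gamma_-^{-1}\star\gamma_+$ with $\gamma_\pm$ algebra maps $H\to A$, $\gamma_-(1)=1$, $\gamma_-(H^+)\subset A_-$ (where $H^+=\bigoplus_{n>0}H_n$), $\gamma_+(H)\subset A_+$; $\gamma_-$ is the unique solution of $\gamma_-=e_A-\mathcal{R}\bigl(\gamma_-\star(\gamma-e_A)\bigr)$. Notation in the Rota--Baxter algebra $(\mathrm{Lin}(H,A),\mathcal{R})$ of weight $-1$, i.e. $\mathcal{R}(f)\star\mathcal{R}(g)=\mathcal{R}(\mathcal{R}(f)\star g+f\star\mathcal{R}(g)-f\star g)$: $(\mathcal{R}a)^{[1]}:=\mathcal{R}(a)$, $(\mathcal{R}a)^{[n+1]}:=\mathcal{R}\bigl((\mathcal{R}a)^{[n]}\star a\bigr)$; the left pre-Lie product is $f\triangleright_{-1}g:=\mathcal{R}(f)\star g-g\star\mathcal{R}(f)+g\star f$; $\mathfrak{l}_{-1}^{(1)}(a):=a$, $\mathfrak{l}_{-1}^{(n+1)}(a):=\mathfrak{l}_{-1}^{(n)}(a)\triangleright_{-1}a$, and $\mathfrak{L}_{-1}^{(n)}(a):=\mathcal{R}\bigl(\mathfrak{l}_{-1}^{(n)}(a)\bigr)$.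 *)

(* Defs.v *)
From HB Require Import structures.
From mathcomp Require Import all_boot all_order all_algebra.
From mathcomp Require Import boolp.

Set Implicit Arguments.
Unset Strict Implicit.
Unset Printing Implicit Defensive.

Import GRing.Theory.
Local Open Scope ring_scope.

Definition is_bilinear (K : fieldType) (U V W : lmodType K) (b : U -> V -> W) :=
  (forall v, linear (b^~ v)) /\ (forall u, linear (b u)).

(* The sequence [:: (u1, v1); ...; (uk, vk)] stands for
   u1 (x) v1 + ... + uk (x) vk; U (x) V is the quotient of these formal sums by
   the smallest congruence that makes (u, v) |-> u (x) v bilinear. *)
Section Tensor.
Variables (K : fieldType) (U V : lmodType K).

Inductive tens_rel : seq (U * V) -> seq (U * V) -> Prop :=
| Tens_refl s : tens_rel s s
| Tens_sym s t : tens_rel s t -> tens_rel t s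
| Tens_trans s t r : tens_rel s t -> tens_rel t r -> tens_rel s r
| Tens_cat s s' t t' : tens_rel s s' -> tens_rel t t' ->
    tens_rel (s ++ t) (s' ++ t')
| Tens_catC s t : tens_rel (s ++ t) (t ++ s)
| Tens_Dl u u' v : tens_rel [:: (u + u', v)] [:: (u, v); (u', v)]
| Tens_Dr u v v' : tens_rel [:: (u, v + v')] [:: (u, v); (u, v')]
| Tens_Z c u v : tens_rel [:: (c *: u, v)] [:: (u, c *: v)]
| Tens_0 v : tens_rel [:: (0, v)] [::].

Definition tens_relb (s t : seq (U * V)) : bool := `[< tens_rel s t >].

Lemma tens_relb_refl : reflexive tens_relb.
Proof. by move=> s; apply/asboolP; apply: Tens_refl. Qed.

Lemma tens_relb_sym : symmetric tens_relb.
Proof. by move=> s t; apply/asboolP/asboolP; apply: Tens_sym. Qed.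

Lemma tens_relb_trans : transitive tens_relb.
Proof.
by move=> t s r /asboolP st /asboolP tr; apply/asboolP; apply: Tens_trans tr.
Qed.

Canonical tens_equiv :=
  EquivRel tens_relb tens_relb_refl tens_relb_sym tens_relb_trans.

Definition tensor := {eq_quot tens_equiv}%qT.
HB.instance Definition _ := Choice.on tensor.

Definition tclass (s : seq (U * V)) : tensor := (\pi_tensor s)%qT.
Definition trepr (t : tensor) : seq (U * V) := repr t.

Lemma treprK t : tclass (trepr t) = t.
Proof. exact: reprK. Qed.

Lemma tclassP s t : tclass s = tclass t <-> tens_rel s t.
Proof.
split=> [/eqmodP/asboolP //|st]; by apply/eqmodP/asboolP.
Qed.

Lemma trepr_rel s : tens_rel (trepr (tclass s)) s.
Proof. by apply/tclassP; rewrite treprK. Qed.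

Definition tensor_zero : tensor := tclass [::].
Definition tensor_add (s t : tensor) : tensor := tclass (trepr s ++ trepr t).
Definition tensor_scale (c : K) (t : tensor) : tensor :=
  tclass [seq (c *: p.1, p.2) | p <- trepr t].

Lemma tensor_addE s t : tensor_add (tclass s) (tclass t) = tclass (s ++ t).
Proof. by apply/tclassP; apply: Tens_cat; apply: trepr_rel. Qed.

Lemma tens_scale_rel c s t : tens_rel s t ->
  tens_rel [seq (c *: p.1, p.2) | p <- s] [seq (c *: p.1, p.2) | p <- t].
Proof.
elim=> {s t} [s|s t _ st|s t r _ st _ tr|s s' t t' _ ss _ tt|s t|u u' v|u v v'
             |d u v|v] /=.
- exact: Tens_refl.
- exact: Tens_sym.
- exact: Tens_trans tr.
- by rewrite !map_cat; apply: Tens_cat.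
- by rewrite !map_cat; apply: Tens_catC.
- by rewrite scalerDr; apply: Tens_Dl.
- exact: Tens_Dr.
- by rewrite scalerA mulrC -scalerA; apply: Tens_Z.
- by rewrite scaler0; apply: Tens_0.
Qed.

Lemma tensor_scaleE c s :
  tensor_scale c (tclass s) = tclass [seq (c *: p.1, p.2) | p <- s].
Proof. by apply/tclassP; apply: tens_scale_rel; apply: trepr_rel. Qed.

Definition tensor_opp (t : tensor) : tensor := tensor_scale (-1) t.

Lemma tensor_addA : associative tensor_add.
Proof.
move=> x y z; rewrite -[x]treprK -[y]treprK -[z]treprK !tensor_addE.
by rewrite catA.
Qed.

Lemma tensor_addC : commutative tensor_add.
Proof.
move=> x y; rewrite -[x]treprK -[y]treprK !tensor_addE.
by apply/tclassP; apply: Tens_catC.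
Qed.

Lemma tensor_add0 : left_id tensor_zero tensor_add.
Proof. by move=> x; rewrite -[x]treprK tensor_addE. Qed.

Lemma tens_cat2 s s' t t' : tclass s = tclass s' -> tclass t = tclass t' ->
  tclass (s ++ t) = tclass (s' ++ t').
Proof. by rewrite -!tensor_addE => -> ->. Qed.

Lemma tensor_scaleDl_seq c d s :
  tclass [seq ((c + d) *: p.1, p.2) | p <- s] =
  tclass ([seq (c *: p.1, p.2) | p <- s] ++ [seq (d *: p.1, p.2) | p <- s]).
Proof.
elim: s => //= -[u v] s IH /=; set C := map _ s in IH *.
set D := map _ s in IH *; set E := map _ s in IH *.
rewrite -cat1s -[_ :: D ++ _]cat1s -[_ :: E]cat1s -!tensor_addE in IH *.
rewrite IH scalerDl.
have -> : tclass [:: (c *: u + d *: u, v)] =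
    tensor_add (tclass [:: (c *: u, v)]) (tclass [:: (d *: u, v)]).
  by rewrite tensor_addE; apply/tclassP; apply: Tens_Dl.
rewrite -!tensor_addA; congr tensor_add.
by rewrite !tensor_addA [tensor_add _ (tclass D)]tensor_addC.
Qed.

Lemma tensor_scale0_seq s : tclass [seq (0 *: p.1, p.2) | p <- s] = tensor_zero.
Proof.
elim: s => //= -[u v] s IH /=.
rewrite -cat1s -tensor_addE IH scale0r [tensor_add _ _]tensor_addC tensor_add0.
by apply/tclassP; apply: Tens_0.
Qed.

Lemma tensor_scaleA c d t :
  tensor_scale c (tensor_scale d t) = tensor_scale (c * d) t.
Proof.
rewrite -[t]treprK !tensor_scaleE -map_comp; congr tclass.
by apply: eq_map => p /=; rewrite scalerA.
Qed.

Lemma tensor_scale1 : left_id 1 tensor_scale.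
Proof.
move=> t; rewrite -[t]treprK tensor_scaleE; congr tclass.
by rewrite -[RHS]map_id; apply: eq_map => -[u v] /=; rewrite scale1r.
Qed.

Lemma tensor_scaleDr : right_distributive tensor_scale tensor_add.
Proof.
move=> c x y; rewrite -[x]treprK -[y]treprK tensor_addE !tensor_scaleE.
by rewrite tensor_addE map_cat.
Qed.

Lemma tensor_scaleDl t :
  {morph tensor_scale^~ t : c d / c + d >-> tensor_add c d}.
Proof.
by move=> c d; rewrite -[t]treprK !tensor_scaleE tensor_addE tensor_scaleDl_seq.
Qed.

Lemma tensor_addN : left_inverse tensor_zero tensor_opp tensor_add.
Proof.
move=> t; rewrite /tensor_opp -{2}[t]tensor_scale1 -tensor_scaleDl addNr.
by rewrite -[t]treprK tensor_scaleE tensor_scale0_seq.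
Qed.

HB.instance Definition _ := GRing.isZmodule.Build tensor
  tensor_addA tensor_addC tensor_add0 tensor_addN.

HB.instance Definition _ := GRing.Zmodule_isLmodule.Build K tensor
  tensor_scaleA tensor_scale1 tensor_scaleDr tensor_scaleDl.

Definition tens (u : U) (v : V) : tensor := tclass [:: (u, v)].

Lemma tclass_sum s : tclass s = \sum_(p <- s) tens p.1 p.2.
Proof.
elim: s => [|[u v] s IH]; first by rewrite big_nil.
by rewrite big_cons -IH -cat1s -tensor_addE.
Qed.

Lemma tensorE t : t = \sum_(p <- trepr t) tens p.1 p.2.
Proof. by rewrite -tclass_sum treprK. Qed.

Lemma tensD s t : tclass s + tclass t = tclass (s ++ t).
Proof. exact: tensor_addE. Qed.

Lemma tensZ c s : c *: tclass s = tclass [seq (c *: p.1, p.2) | p <- s].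
Proof. exact: tensor_scaleE. Qed.

Lemma tens_bilinear : is_bilinear tens.
Proof.
split=> [v c u u' | u c v v']; rewrite /tens tensZ tensD /=; apply/tclassP.
- exact: Tens_Dl.
- apply: Tens_trans (Tens_Dr _ _ _) _.
  apply: (@Tens_cat [:: _] [:: _] [:: _] [:: _]); last exact: Tens_refl.
  by apply: Tens_sym; apply: Tens_Z.
Qed.

(* For bilinear b, this is the linear map U (x) V -> W induced by b; the choice
   of representative only matters when b is not bilinear. *)
Definition tlift (W : lmodType K) (b : U -> V -> W) (t : tensor) : W :=
  \sum_(p <- trepr t) b p.1 p.2.

Section Lift.
Variables (W : lmodType K) (b : U -> V -> W) (bP : is_bilinear b).

Let bDl u u' v : b (u + u') v = b u v + b u' v.
Proof. by have := bP.1 v 1 u u'; rewrite !scale1r. Qed.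
Let bDr u v v' : b u (v + v') = b u v + b u v'.
Proof. by have := bP.2 u 1 v v'; rewrite !scale1r. Qed.
Let b0l v : b 0 v = 0.
Proof. by apply: (addrI (b 0 v)); rewrite -bDl !addr0. Qed.
Let b0r u : b u 0 = 0.
Proof. by apply: (addrI (b u 0)); rewrite -bDr !addr0. Qed.
Let bZl c u v : b (c *: u) v = c *: b u v.
Proof. by have := bP.1 v c u 0; rewrite b0l !addr0. Qed.
Let bZr c u v : b u (c *: v) = c *: b u v.
Proof. by have := bP.2 u c v 0; rewrite b0r !addr0. Qed.

Lemma tens_rel_sum s t : tens_rel s t ->
  \sum_(p <- s) b p.1 p.2 = \sum_(p <- t) b p.1 p.2.
Proof.
elim=> {s t} [s|s t _ st|s t r _ st _ tr|s s' t t' _ ss _ tt|s t|u u' v|u v v'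
             |c u v|v] //=.
- by rewrite st tr.
- by rewrite !big_cat /= ss tt.
- by rewrite !big_cat /= addrC.
- by rewrite !big_cons !big_nil /= !addr0 bDl.
- by rewrite !big_cons !big_nil /= !addr0 bDr.
- by rewrite !big_cons !big_nil /= !addr0 bZl bZr.
- by rewrite !big_cons !big_nil /= !addr0 b0l.
Qed.

Lemma tlift_class s : tlift b (tclass s) = \sum_(p <- s) b p.1 p.2.
Proof. by apply: tens_rel_sum; apply: trepr_rel. Qed.

Lemma tlift_tens u v : tlift b (tens u v) = b u v.
Proof. by rewrite tlift_class big_seq1. Qed.

Lemma tlift_linear : linear (tlift b).
Proof.
move=> c s t; rewrite -[s]treprK -[t]treprK.
rewrite tensZ tensD !tlift_class big_cat /=.
congr (_ + _); rewrite big_map scaler_sumr.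
by apply: eq_bigr => p _ /=; rewrite bZl.
Qed.
End Lift.

End Tensor.

Section HopfAlgebra.
Variable K : fieldType.

Definition tmap (U V U' V' : lmodType K) (f : U -> U') (g : V -> V') :
    tensor U V -> tensor U' V' :=
  tlift (fun u v => tens (f u) (g v)).

Definition tassoc (U V W : lmodType K) :
    tensor (tensor U V) W -> tensor U (tensor V W) :=
  tlift (fun t w => tlift (fun u v => tens u (tens v w)) t).

Definition tmul (B : algType K) (s t : tensor B B) : tensor B B :=
  tlift (fun x y => tlift (fun x' y' => tens (x * x') (y * y')) t) s.

Record hopfAlgebra (H : comAlgType K) := HopfAlgebra {
  coprod : {linear H -> tensor H H};
  counit : {lrmorphism H -> K^o};
  antipode : {linear H -> H};
  coprod1 : coprod 1 = tens 1 1;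
  coprodM : forall x y, coprod (x * y) = tmul (coprod x) (coprod y);
  coprodA : forall x,
    tassoc (tmap coprod id (coprod x)) = tmap id coprod (coprod x);
  counitl : forall x, tlift (fun y z => counit y *: z) (coprod x) = x;
  counitr : forall x, tlift (fun y z => counit z *: y) (coprod x) = x;
  antipodel : forall x,
    tlift (fun y z => antipode y * z) (coprod x) = (counit x : K)%:A;
  antipoder : forall x,
    tlift (fun y z => y * antipode z) (coprod x) = (counit x : K)%:A
}.

Definition direct_sum_decomp (V : lmodType K) (G : nat -> {pred V}) : Prop :=
  [/\ forall n, submod_closed (G n),
      forall x, exists N (c : nat -> V),
        (forall i, c i \in G i) /\ x = \sum_(i < N) c i
    & forall N (c : nat -> V), (forall i, c i \in G i) ->
        \sum_(i < N) c i = 0 -> forall i, (i < N)%N -> c i = 0].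

(* Membership in the image of P (x) Q, for subspaces P and Q. *)
Definition in_tens (U V : lmodType K) (P : {pred U}) (Q : {pred V})
    (t : tensor U V) : Prop :=
  exists2 s : seq (U * V),
    (forall p, p \in s -> p.1 \in P /\ p.2 \in Q)
    & t = \sum_(p <- s) tens p.1 p.2.

Definition graded_connected (H : comAlgType K) (hH : hopfAlgebra H)
    (G : nat -> {pred H}) : Prop :=
  [/\ direct_sum_decomp G,
      (1 \in G 0%N) /\
        (forall m n x y, x \in G m -> y \in G n -> x * y \in G (m + n)%N),
      (forall n x, x \in G n ->
         exists2 t : nat -> tensor H H,
           (forall i, (i <= n)%N -> in_tens (G i) (G (n - i)%N) (t i))
           & coprod hH x = \sum_(i < n.+1) t i) /\
        (forall n x, (0 < n)%N -> x \in G n -> counit hH x = 0),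
      forall n x, x \in G n -> antipode hH x \in G n
    & forall x, x \in G 0%N <-> exists c : K, x = c%:A].

Definition positive_part (H : comAlgType K) (G : nat -> {pred H}) (x : H) :=
  exists N (c : nat -> H),
    (forall i, c i \in G i) /\ x = \sum_(1 <= i < N) c i.

(* Am is a subalgebra that need not contain 1. *)
Definition splitting (A : comAlgType K) (Ap Am : {pred A}) : Prop :=
  [/\ subalg_closed Ap,
      submod_closed Am /\ GRing.mulr_2closed Am,
      forall x, exists y z, [/\ y \in Ap, z \in Am & x = y + z]
    & forall x, x \in Ap -> x \in Am -> x = 0].

Definition projector_along (A : comAlgType K) (Ap Am : {pred A})
    (R : A -> A) : Prop :=
  (forall x, x \in Am -> R x = x) /\ (forall x, x \in Ap -> R x = 0).

Section Convolution.
Variables (H : comAlgType K) (hH : hopfAlgebra H) (A : comAlgType K).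
Implicit Types f g : {linear H -> A}.

Definition conv_fun f g (h : H) : A :=
  tlift (fun x y => f x * g y) (coprod hH h).

Lemma conv_bilinear f g : is_bilinear (fun x y => f x * g y).
Proof.
split=> [y c x x' | x c y y'] /=.
- by rewrite linearP mulrDl scalerAl.
- by rewrite linearP mulrDr scalerAr.
Qed.

Lemma conv_fun_linear f g : linear (conv_fun f g).
Proof.
by move=> c x y; rewrite /conv_fun linearP (tlift_linear (conv_bilinear f g)).
Qed.

HB.instance Definition _ f g :=
  GRing.isLinear.Build K H A *:%R (conv_fun f g) (conv_fun_linear f g).

Definition conv f g : {linear H -> A} := conv_fun f g.

Definition conv_unit_fun (h : H) : A := (counit hH h : K)%:A.

Lemma conv_unit_linear : linear conv_unit_fun.
Proof.
by move=> c x y; rewrite /conv_unit_fun linearP scalerDl scalerA.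
Qed.

HB.instance Definition _ :=
  GRing.isLinear.Build K H A *:%R conv_unit_fun conv_unit_linear.

Definition conv_unit : {linear H -> A} := conv_unit_fun.

Definition bogoliubov (G : nat -> {pred H}) (Ap Am : {pred A})
    (gamma gm gp : {lrmorphism H -> A}) : Prop :=
  [/\ gm 1 = 1,
      forall x, positive_part G x -> gm x \in Am,
      forall x, gp x \in Ap
    & exists gmV : {linear H -> A},
      [/\ conv gmV gm = conv_unit, conv gm gmV = conv_unit
        & (gamma : {linear H -> A}) = conv gmV gp]].

Variable R : {linear A -> A}.

Definition RB f : {linear H -> A} := R \o f.

Definition prelie f g : {linear H -> A} :=
  (conv (RB f) g \- conv g (RB f)) \+ conv g f.

(* In the next three definitions n ranges over n > 0; the value at n = 0 is
   meaningless and never used. *)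
Definition RBiter (a : {linear H -> A}) (n : nat) : {linear H -> A} :=
  iter n.-1 (fun f => RB (conv f a)) (RB a).

Definition lpre (a : {linear H -> A}) (n : nat) : {linear H -> A} :=
  iter n.-1 (fun f => prelie f a) a.

Definition Lpre (a : {linear H -> A}) (n : nat) : {linear H -> A} :=
  RB (lpre a n).

(* Compositions of n of length k are the maps i : 'I_k -> 'I_n.+1 with positive
   values summing to n. *)
Definition composition_sum (a : {linear H -> A}) (n : nat) (h : H) : A :=
  \sum_(1 <= k < n.+1)
   \sum_(i : {ffun 'I_k -> 'I_n.+1} |
           [forall j, (0 < i j)%N] && ((\sum_j i j)%N == n))
     (\prod_(j < k) (\sum_(l < k | (l <= j)%N) i l)%N%:R : K)^-1 *:
       (\big[conv/conv_unit]_(j < k) Lpre a (i j)) h.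

(* s is the sum over n > 0 of the F n, only finitely many of which are nonzero
   at any given h. *)
Definition pointwise_sum (F : nat -> H -> A) (s : H -> A) : Prop :=
  forall h, exists N,
    (forall n, (N < n)%N -> F n h = 0) /\ s h = \sum_(1 <= n < N.+1) F n h.

End Convolution.
End HopfAlgebra.

(* Main.v *)
(* Put T f = R (f * a). Since gamma = gm^-1 * gp and R kills gp, gm is a fixed
   point of f |-> e + T f; as a vanishes in degree 0, T^n f vanishes in degrees
   below n, so iterating gives gm = e + sum_(n > 0) X_n with X_n = T^n e. The
   composition sum of degree n equals X_n exactly: both satisfy
   n X_n = sum_(1 <= k <= n) X_(n-k) * R l_k, for X_n by the Rota-Baxter
   relation and for the composition sum by splitting off the last part. *)
From HB Require Import structures.
From mathcomp Require Import all_boot all_order all_algebra.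
From mathcomp Require Import boolp ring.
Require Import Defs.

Set Implicit Arguments.
Unset Strict Implicit.
Unset Printing Implicit Defensive.

Import GRing.Theory.
Local Open Scope ring_scope.

(** * Rota-Baxter identities of weight -1 in a possibly noncommutative ring *)

Section RotaBaxter.
Variables (B : nzRingType) (R : {additive B -> B}).
Hypothesis rota_baxter :
  forall x y, R x * R y = R (R x * y + x * R y - x * y).

Definition rb_prelie (x y : B) := R x * y - y * R x + y * x.
Definition rb_iter (a : B) n := iter n (fun x => R (x * a)) 1.
(* rb_lpre a n is l_n for n > 0; the value at n = 0 is junk. *)
Definition rb_lpre (a : B) n := iter n.-1 (rb_prelie^~ a) a.

(* The Rota-Baxter relation and the definition of l_(k+1) turn
   X_(n+1-k) * R l_k into R (X_(n-k) * R l_k * a) plus a term telescoping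
   in k. *)
Lemma rb_iter_dynkin a n :
  rb_iter a n *+ n =
  \sum_(1 <= k < n.+1) rb_iter a (n - k) * R (rb_lpre a k).
Proof.
elim: n => [|n IH]; first by rewrite big_geq.
have step k : (1 <= k < n.+1)%N ->
    rb_iter a (n.+1 - k) * R (rb_lpre a k) =
    R (rb_iter a (n - k) * R (rb_lpre a k) * a)
    - R (rb_iter a (n.+1 - k.+1) * rb_lpre a k.+1
         - rb_iter a (n.+1 - k) * rb_lpre a k).
  case: k => // k /= ltkn; rewrite ltnS in ltkn.
  rewrite !subSS -(subnSK ltkn) /= rota_baxter -raddfB; congr (R _).
  rewrite /rb_prelie mulrDr mulrBr !mulrA.
  set p := R _ * _; set q := _ * R _; set r := _ * _ * iter _ _ _.
  set s := _ * R _ * a.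
  by rewrite opprB addrCA -addrA -addrA opprD addNKr opprD opprK addrA.
(* Telescoping leaves R (X_n a) - R l_(n+1), whose second term cancels the summand k = n+1. By
   induction the other sum is n R (X_n a), which gives (n+1) X_(n+1) in total. *)
rewrite big_nat_recr //= subnn mul1r (eq_big_nat _ _ step) sumrB -!raddf_sum.
rewrite telescope_sumr //= subnn mul1r -mulr_suml -IH mulrnAl raddfMn subn1.
by rewrite /= raddfB opprB addrA subrK mulrSr.
Qed.

(** With T y = R (y a), applying the additive map T^n to x = 1 + T x gives T^n x = T^n 1 + T^(n+1)
    x; each step splits off one more iterate. *)
Lemma rb_iter_remainder a x n : x = 1 + R (x * a) ->
  x - \sum_(0 <= k < n) rb_iter a k = iter n (fun y => R (y * a)) x.
Proof.
move=> xE; set T := fun y => R (y * a).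
have iterD m y z : iter m T (y + z) = iter m T y + iter m T z.
  by elim: m => //= m ->; rewrite /T mulrDl raddfD.
elim: n => [|n IH]; first by rewrite big_geq ?subr0.
by rewrite big_nat_recr //= opprD addrA IH {1}xE iterD addrC addKr -iterSr.
Qed.

End RotaBaxter.

(** * Sums over compositions of an integer, by recursion on the last part *)

Section CompositionSum.
Variables (K : fieldType) (B : algType K) (L : nat -> B) (M : nat).

Definition ffun_rcons (T : Type) k (p : {ffun 'I_k -> T} * T) :
    {ffun 'I_k.+1 -> T} :=
  [ffun j => if unlift ord_max j is Some j' then p.1 j' else p.2].

Lemma ffun_rcons_widen (T : Type) k (p : {ffun 'I_k -> T} * T) j :
  ffun_rcons p (widen_ord (leqnSn k) j) = p.1 j.
Proof.
have -> : widen_ord (leqnSn k) j = lift ord_max j.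
  by apply: val_inj; symmetry; exact: lift_max.
by rewrite ffunE liftK.
Qed.

Lemma ffun_rcons_max (T : Type) k (p : {ffun 'I_k -> T} * T) :
  ffun_rcons p ord_max = p.2.
Proof. by rewrite ffunE unlift_none. Qed.

(** Splitting a composition into its initial parts and its last part thus becomes a reindexing of
    the sum. *)
Lemma ffun_rcons_bij (T : Type) k : bijective (@ffun_rcons T k).
Proof.
exists (fun f : {ffun 'I_k.+1 -> T} =>
  ([ffun j => f (widen_ord (leqnSn k) j)], f ord_max)).
  case=> g m; rewrite ffun_rcons_max; congr pair; apply/ffunP => j.
  by rewrite ffunE ffun_rcons_widen.
move=> f; apply/ffunP => j; rewrite ffunE; case: unliftP => [i|] -> //=.
by rewrite ffunE; congr (f _); apply: val_inj; symmetry; exact: lift_max.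
Qed.

Definition psums_prod k (i : {ffun 'I_k -> 'I_M.+1}) : K :=
  \prod_(j < k) (\sum_(l < k | (l <= j)%N) i l)%N%:R.

(** The parts are bounded by a fixed [M] rather than by [n]: the recursion lowers [n], and all its
    instances must sum over the same index type. *)
Definition comp_sum k n : B :=
  \sum_(i : {ffun 'I_k -> 'I_M.+1} |
         [forall j, (0 < i j)%N] && ((\sum_j i j)%N == n))
    (psums_prod i)^-1 *: \prod_(j < k) L (i j).

Lemma comp_sum0 n : comp_sum 0 n = (n == 0%N)%:R.
Proof.
rewrite /comp_sum eq_sym; case: eqP => [<-|/eqP n0].
  rewrite (big_pred1 [ffun=> ord0]) => [|i].
    by rewrite /psums_prod !big_ord0 invr1 scale1r.
  rewrite big_ord0 eqxx andbT; apply/forallP/eqP => [_|_ []//].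
  by apply/ffunP => -[].
by rewrite big_pred0 // => i; rewrite big_ord0 (negPf n0) andbF.
Qed.

Lemma forall_ffun_rcons k (P : pred 'I_M.+1) (p : {ffun 'I_k -> _} * _) :
  [forall j, P (ffun_rcons p j)] = [forall j, P (p.1 j)] && P p.2.
Proof.
apply/forallP/andP => [Pp|[/forallP Pg Pm] j].
  split; last by rewrite -(ffun_rcons_max p).
  by apply/forallP => j; rewrite -ffun_rcons_widen.
by rewrite ffunE; case: unliftP.
Qed.

Lemma sum_ffun_rcons k (p : {ffun 'I_k -> 'I_M.+1} * _) :
  (\sum_j ffun_rcons p j = \sum_j p.1 j + p.2)%N.
Proof.
rewrite big_ord_recr /= ffun_rcons_max; congr addn.
by apply: eq_bigr => j _; rewrite ffun_rcons_widen.
Qed.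

Lemma prod_ffun_rcons k (p : {ffun 'I_k -> 'I_M.+1} * _) :
  \prod_j L (ffun_rcons p j) = \prod_j L (p.1 j) * L p.2.
Proof.
rewrite big_ord_recr /= ffun_rcons_max; congr (_ * _).
by apply: eq_bigr => j _; rewrite ffun_rcons_widen.
Qed.

(** The earlier partial sums do not see the appended part, and the new one is the total. *)
Lemma psums_prod_rcons k (p : {ffun 'I_k -> 'I_M.+1} * 'I_M.+1) :
  psums_prod (ffun_rcons p) = psums_prod p.1 * (\sum_j p.1 j + p.2)%N%:R.
Proof.
rewrite /psums_prod big_ord_recr /=; congr (_ * _).
  apply: eq_bigr => j _.
  rewrite big_mkcond big_ord_recr /= leqNgt ltn_ord addn0 -big_mkcond.
  by congr (_%:R); apply: eq_bigr => l _; rewrite ffun_rcons_widen.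
congr (_%:R); rewrite big_mkcond big_ord_recr /= leqnn ffun_rcons_max.
congr addn.
by apply: eq_bigr => l _; rewrite ffun_rcons_widen ltnW.
Qed.

(** In every composition of [n] the last denominator factor is [n] itself, so it comes out of the
    sum over the last part m. *)
Lemma comp_sum_recr k n : (n <= M)%N ->
  comp_sum k.+1 n =
  n%:R^-1 *: \sum_(1 <= m < n.+1) comp_sum k (n - m)%N * L m.
Proof.
move=> leMn.
(* Here m ranges over ['I_M.+1], the type that the reindexing produces; [n <= M] later turns this
   into the range from 1 to n. *)
transitivity (n%:R^-1 *:
    \sum_(m < M.+1 | (0 < m <= n)%N) comp_sum k (n - m)%N * L m).
  rewrite /comp_sum (reindex (@ffun_rcons _ k)) /=; last first.
    exact: onW_bij (ffun_rcons_bij _ _).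
  rewrite scaler_sumr.
  under [RHS]eq_bigr do rewrite mulr_suml scaler_sumr.
  rewrite (exchange_big_dep xpredT) //= pair_big_dep /=.
  apply: eq_big => [[g m]|[g m]] /=.
    rewrite (forall_ffun_rcons (fun x => 0 < x)%N) sum_ffun_rcons /=.
    rewrite [RHS]andbCA -!andbA; congr (_ && _).
    case: (leqP m n) => [lemn|ltnm] /=.
      by congr (_ && _); rewrite -[RHS](eqn_add2r m) subnK.
    by rewrite gtn_eqF // ltn_addl.
  rewrite sum_ffun_rcons => /andP[_ /eqP /= <-].
  by rewrite psums_prod_rcons prod_ffun_rcons -scalerAl scalerA invfM mulrC.
congr (_ *: _).
rewrite -(big_mkord (fun m => 0 < m <= n)%N
  (fun m => comp_sum k (n - m)%N * L m)).
rewrite big_ltn_cond //= (big_cat_nat (n := n.+1)) //=.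
rewrite [X in _ + X]big1_seq ?addr0.
  rewrite [LHS]big_nat_cond [RHS]big_nat; apply: eq_bigl => m.
  by rewrite ltnS andbb.
by move=> m /andP[/andP[_ lemn]]; rewrite mem_index_iota ltnNge lemn.
Qed.

(** Summed over all lengths, the last-part recursion becomes the one assumed for [X], and division
    by positive integers makes its solution unique. Lengths below [N] suffice, since positive parts
    bound the length by n. *)
Lemma sum_comp_sum (X : nat -> B) N n :
  (forall p, (0 < p)%N -> p%:R != 0 :> K) -> X 0%N = 1 ->
  (forall p, X p *+ p = \sum_(1 <= m < p.+1) X (p - m)%N * L m) ->
  (n <= M)%N -> (n < N)%N -> \sum_(0 <= k < N) comp_sum k n = X n.
Proof.
move=> K0 X0 Xrec; elim: N n => // N IH n leMn; rewrite ltnS => leNn.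
rewrite big_nat_recl // comp_sum0.
case: (posnP n) => [->|n_gt0].
  rewrite X0 big1 ?addr0 // => k _.
  by rewrite comp_sum_recr // big_geq // scaler0.
rewrite add0r; under eq_bigr do rewrite comp_sum_recr //.
rewrite -scaler_sumr exchange_big /=.
transitivity (n%:R^-1 *: (X n *+ n)); last first.
  by rewrite -scaler_nat scalerA mulVf ?scale1r // K0.
rewrite Xrec; congr (_ *: _); apply: eq_big_nat => m /andP[m_gt0 lemn].
(* Removing a part m > 0 lowers n strictly, so n - m stays below the decreased bound on lengths. *)
rewrite -mulr_suml IH //; first by rewrite (leq_trans (leq_subr _ _)).
by rewrite (leq_trans _ leNn) // ltn_subrL m_gt0.
Qed.

End CompositionSum.

(** * Linear maps on tensor products *)

Section TensorMaps.
Variable K : fieldType.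
Implicit Types U V W : lmodType K.

(** Linear maps bundle proofs, so proof irrelevance is needed on top of function extensionality.
    This makes the laws of convolution genuine equalities. *)
Lemma linear_ext U V (f g : {linear U -> V}) : f =1 g -> f = g.
Proof.
case: f g => [f [[fA] [fS]]] [g [[gA] [gS]]] /= /funext fg.
subst g; have -> : fA = gA by exact: Prop_irrelevance.
by have -> : fS = gS by exact: Prop_irrelevance.
Qed.

Lemma linear_fun_sum U V (f : U -> V) : linear f ->
  forall (I : Type) (r : seq I) (F : I -> U),
  f (\sum_(i <- r) F i) = \sum_(i <- r) f (F i).
Proof.
move=> lf I r F; pose g := HB.pack_for {linear U -> V} f
  (GRing.isLinear.Build _ _ _ _ f lf).
exact: (linear_sum g).
Qed.

Lemma tens_ext U V W (f g : tensor U V -> W) : linear f -> linear g ->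
  (forall u v, f (tens u v) = g (tens u v)) -> f =1 g.
Proof.
move=> lf lg fg t; rewrite [t]tensorE !linear_fun_sum //.
by apply: eq_bigr => p _; apply: fg.
Qed.

Lemma comp_linear U V W (f : U -> V) (g : V -> W) :
  linear f -> linear g -> linear (g \o f).
Proof. by move=> lf lg c x y; rewrite /= lf lg. Qed.

Lemma tmap_bilinear U V U' V' (f : {linear U -> U'}) (g : {linear V -> V'}) :
  is_bilinear (fun u v => tens (f u) (g v)).
Proof.
have [tl tr] := tens_bilinear U' V'.
by split=> [v c u u'|u c v v']; rewrite linearP; [apply: tl|apply: tr].
Qed.

Lemma tassoc_bilinear U V W : is_bilinear (fun (t : tensor U V) (w : W) =>
  tlift (fun u v => tens u (tens v w)) t).
Proof.
split=> [w|t c w w'].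
  apply: tlift_linear; split=> [v c u u'|u c v v'].
    exact: (tens_bilinear _ _).1.
  by rewrite (tens_bilinear _ _).1 (tens_bilinear _ _).2.
(* Linearity in the last factor holds termwise, because the representative of [t] stays fixed. *)
rewrite /tlift scaler_sumr -big_split /=; apply: eq_bigr => p _.
by rewrite !(tens_bilinear _ _).2.
Qed.

End TensorMaps.

(** * Linear maps from H to A as an algebra under convolution *)

Section ConvolutionAlgebra.
Variables (K : fieldType) (H : comAlgType K) (hH : hopfAlgebra H).
Variable A : comAlgType K.
Implicit Types f g k : {linear H -> A}.

(* Both sides are values at (Delta (x) id) Delta h = (id (x) Delta) Delta h of
   the linear map x (x) (y (x) z) |-> f x * (g y * k z). *)
Lemma convA : associative (@conv K H hH A).
Proof.
move=> f g k; apply: linear_ext => h /=.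
pose Phi := tlift (fun x (t : tensor H H) =>
  f x * tlift (fun y z => g y * k z) t).
have Phi_bil : is_bilinear (fun x (t : tensor H H) =>
    f x * tlift (fun y z => g y * k z) t).
  split=> [t c x x'|x c t t']; first by rewrite linearP mulrDl scalerAl.
  by rewrite (tlift_linear (conv_bilinear g k)) mulrDr scalerAr.
have Phi_lin : linear Phi := tlift_linear Phi_bil.
have id_coprod_bil := tmap_bilinear (@idfun H) (coprod hH).
have coprod_id_bil := tmap_bilinear (coprod hH) (@idfun H).
transitivity (Phi (tmap id (coprod hH) (coprod hH h))).
  apply: (tens_ext (tlift_linear (conv_bilinear f (conv hH g k)))
    (comp_linear (tlift_linear id_coprod_bil) Phi_lin) _ (coprod hH h))
    => x y /=.
  rewrite (tlift_tens (conv_bilinear f (conv hH g k))).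
  by rewrite (tlift_tens id_coprod_bil) /Phi tlift_tens.
rewrite -coprodA; apply/esym.
apply: (tens_ext (tlift_linear (conv_bilinear (conv hH f g) k))
  (comp_linear (tlift_linear coprod_id_bil)
    (comp_linear (tlift_linear (tassoc_bilinear H H H)) Phi_lin)) _ (coprod hH h))
  => x y /=.
rewrite (tlift_tens (conv_bilinear (conv hH f g) k)) (tlift_tens coprod_id_bil).
rewrite (tlift_tens (tassoc_bilinear H H H)) /= /conv_fun.
have mulk_lin : linear ( *%R^~ (k y)) by move=> c u v; rewrite mulrDl scalerAl.
have tensy_bil : is_bilinear (fun u v : H => tens u (tens v y)).
  split=> [v c u u'|u c v v']; first exact: (tens_bilinear _ _).1.
  by rewrite (tens_bilinear _ _).1 (tens_bilinear _ _).2.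
apply: (tens_ext (comp_linear (tlift_linear (conv_bilinear f g)) mulk_lin)
  (comp_linear (tlift_linear tensy_bil) Phi_lin) _ (coprod hH x)) => u v /=.
rewrite (tlift_tens (conv_bilinear f g)) (tlift_tens tensy_bil) /Phi.
by rewrite tlift_tens // (tlift_tens (conv_bilinear g k)) mulrA.
Qed.

(** The image under [f] of the counit axiom; on pure tensors both sides are counit(y) f(z). *)
Lemma conv1f : left_id (conv_unit hH A) (@conv K H hH A).
Proof.
move=> f; apply: linear_ext => h.
rewrite -[RHS](congr1 f (counitl hH h)).
have e_bil : is_bilinear (fun y z : H => (counit hH y : K) *: z).
  split=> [z c y y'|y c z z']; first by rewrite linearP scalerDl scalerA.
  by rewrite scalerDr !scalerA mulrC.
rewrite /= /conv_fun; apply: (tens_ext (tlift_linear (conv_bilinear _ _))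
  (comp_linear (tlift_linear e_bil) (linearP f))) => y z /=.
by rewrite (tlift_tens (conv_bilinear _ _)) tlift_tens // linearZ /= mulr_algl.
Qed.

Lemma convf1 : right_id (conv_unit hH A) (@conv K H hH A).
Proof.
move=> f; apply: linear_ext => h.
rewrite -[RHS](congr1 f (counitr hH h)).
have e_bil : is_bilinear (fun y z : H => (counit hH z : K) *: y).
  split=> [z c y y'|y c z z']; last by rewrite linearP scalerDl scalerA.
  by rewrite scalerDr !scalerA mulrC.
rewrite /= /conv_fun; apply: (tens_ext (tlift_linear (conv_bilinear _ _))
  (comp_linear (tlift_linear e_bil) (linearP f))) => y z /=.
by rewrite (tlift_tens (conv_bilinear _ _)) tlift_tens // linearZ /= mulrC
  mulr_algl.
Qed.

(** Both sides are sums over the same representative of the coproduct of h, so the law reduces to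
    distributivity in A. *)
Lemma convDl f g k : conv hH (f \+ g) k = conv hH f k \+ conv hH g k.
Proof.
apply: linear_ext => h /=; rewrite /conv_fun /tlift -big_split.
by apply: eq_bigr => p _; rewrite mulrDl.
Qed.

Lemma convDr f g k : conv hH f (g \+ k) = conv hH f g \+ conv hH f k.
Proof.
apply: linear_ext => h /=; rewrite /conv_fun /tlift -big_split.
by apply: eq_bigr => p _; rewrite mulrDr.
Qed.

Lemma convZl c f g : conv hH (c \*: f) g = c \*: conv hH f g.
Proof.
apply: linear_ext => h /=; rewrite /conv_fun /tlift scaler_sumr.
by apply: eq_bigr => p _; rewrite scalerAl.
Qed.

Lemma convZr c f g : conv hH f (c \*: g) = c \*: conv hH f g.
Proof.
apply: linear_ext => h /=; rewrite /conv_fun /tlift scaler_sumr.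
by apply: eq_bigr => p _; rewrite scalerAr.
Qed.

(* An alias recording the coproduct that determines the product. *)
Definition conv_alg of hopfAlgebra H := {linear H -> A}.
Local Notation B := (conv_alg hH).

HB.instance Definition _ := gen_eqMixin B.
HB.instance Definition _ := gen_choiceMixin B.

Definition conv_add : B -> B -> B := fun f g => f \+ g.
Definition conv_zero : B := (\0).
Definition conv_opp : B -> B := fun f => \- f.
Definition conv_scale : K -> B -> B := fun c f => c \*: f.

Lemma conv_addA : associative conv_add.
Proof. by move=> f g k; apply: linear_ext => h /=; rewrite addrA. Qed.
Lemma conv_addC : commutative conv_add.
Proof. by move=> f g; apply: linear_ext => h /=; rewrite addrC. Qed.
Lemma conv_add0 : left_id conv_zero conv_add.
Proof. by move=> f; apply: linear_ext => h /=; rewrite add0r. Qed.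
Lemma conv_addN : left_inverse conv_zero conv_opp conv_add.
Proof. by move=> f; apply: linear_ext => h /=; rewrite addNr. Qed.
HB.instance Definition _ := GRing.isZmodule.Build B
  conv_addA conv_addC conv_add0 conv_addN.

Lemma conv_oner_neq0 : (conv_unit hH A : B) != 0.
Proof.
apply/eqP => /(congr1 (fun f : {linear H -> A} => f 1)) /=.
by rewrite /conv_unit_fun rmorph1 scale1r; apply/eqP/oner_neq0.
Qed.

HB.instance Definition _ := GRing.Zmodule_isNzRing.Build B
  convA conv1f convf1 convDl convDr conv_oner_neq0.

Lemma conv_scaleA c d f : conv_scale c (conv_scale d f) = conv_scale (c * d) f.
Proof. by apply: linear_ext => h /=; rewrite scalerA. Qed.
Lemma conv_scale1 : left_id 1 conv_scale.
Proof. by move=> f; apply: linear_ext => h /=; rewrite scale1r. Qed.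
Lemma conv_scaleDr : right_distributive conv_scale +%R.
Proof. by move=> c f g; apply: linear_ext => h /=; rewrite scalerDr. Qed.
Lemma conv_scaleDl f : {morph conv_scale^~ f : c d / c + d}.
Proof. by move=> c d; apply: linear_ext => h /=; rewrite scalerDl. Qed.
HB.instance Definition _ := GRing.Zmodule_isLmodule.Build K B
  conv_scaleA conv_scale1 conv_scaleDr conv_scaleDl.

HB.instance Definition _ := GRing.Lmodule_isLalgebra.Build K B
  (fun c f g => esym (convZl c f g)).
HB.instance Definition _ := GRing.Lalgebra_isAlgebra.Build K B
  (fun c f g => esym (convZr c f g)).

End ConvolutionAlgebra.

(** * The Bogoliubov recursion and convergence along the grading *)

Section Bogoliubov.
Variables (K : fieldType) (H : comAlgType K) (hH : hopfAlgebra H).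
Variables (A : comAlgType K) (R : {linear A -> A}).
Local Notation B := (conv_alg A hH).

Lemma conv_algE (I : Type) (r : seq I) (P : pred I) (F : I -> B) h :
  (\sum_(i <- r | P i) F i) h = \sum_(i <- r | P i) F i h.
Proof. exact: (big_morph (fun f : B => f h)). Qed.

Definition conv_RB : B -> B := RB R.

Lemma conv_RB_additive : zmod_morphism conv_RB.
Proof. by move=> f g; apply: linear_ext => h /=; rewrite linearB. Qed.
HB.instance Definition _ :=
  GRing.isZmodMorphism.Build B B conv_RB conv_RB_additive.

Lemma lpreE (a : B) n : lpre hH R a n = rb_lpre conv_RB a n.
Proof. by apply: eq_iter => f; apply: linear_ext. Qed.

(** The two indexings meet only from 1 on: [rb_iter] starts from the unit, and its first step yields
    R (1 a) = R a. *)
Lemma RBiterE (a : B) n : RBiter hH R a n.+1 = rb_iter conv_RB a n.+1.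
Proof. by rewrite /rb_iter iterSr mul1r. Qed.

(** Here the bound on the parts is taken to be [n] itself. *)
Lemma composition_sumE (a : B) n h :
  composition_sum hH R a n h =
  (\sum_(1 <= k < n.+1)
     comp_sum (fun m => conv_RB (rb_lpre conv_RB a m)) n k n : B) h.
Proof.
rewrite conv_algE; apply: eq_bigr => k _; rewrite conv_algE.
apply: eq_bigr => i _; congr (_ *: _).
apply: (congr1 (fun f : {linear H -> A} => f h)).
by apply: eq_bigr => j _; rewrite -lpreE.
Qed.

Lemma conv_rota_baxter :
    (forall x y, R x * R y = R (R x * y + x * R y - x * y)) ->
  forall f g : B, conv_RB f * conv_RB g =
    conv_RB (conv_RB f * g + f * conv_RB g - f * g).
Proof.
move=> RR f g; apply: linear_ext => h /=.
rewrite /conv_fun /tlift -!big_split -sumrB linear_sum.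
by apply: eq_bigr => p _ /=; rewrite RR.
Qed.

(** Writing x = x_+ + x_- and y = y_+ + y_-, the argument of R collapses to x_- y_- - x_+ y_+. Both
    parts being closed under products, R keeps the first term and kills the second. *)
Lemma projector_rota_baxter (Ap Am : {pred A}) :
    splitting Ap Am -> projector_along Ap Am R ->
  forall x y, R x * R y = R (R x * y + x * R y - x * y).
Proof.
case=> [[_ _ ApM] [_ AmM] dec _] [Rm Rp] x y.
have [xp [xm [xpP xmP ->]]] := dec x; have [yp [ym [ypP ymP ->]]] := dec y.
rewrite [R (xp + _)]linearD [R (yp + _)]linearD (Rp xp) //
  (Rp yp) // (Rm xm) // (Rm ym) // !add0r.
have -> : xm * (yp + ym) + (xp + xm) * ym - (xp + xm) * (yp + ym) =
  xm * ym - xp * yp by ring.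
by rewrite linearB Rm ?AmM // Rp ?ApM // subr0.
Qed.

Variables (G : nat -> {pred H}) (grH : graded_connected hH G).

Definition vanish_below (f : H -> A) n :=
  forall i x, (i < n)%N -> x \in G i -> f x = 0.

(** The coproduct of an element of degree i <= n has components of bidegree (j, i - j). Either j < n
    and [f] vanishes, or i - j = 0 and [a] vanishes. *)
Lemma vanish_below_conv (f a : {linear H -> A}) n :
  vanish_below f n -> vanish_below a 1 -> vanish_below (conv hH f a) n.+1.
Proof.
move=> f0 a0 i x; rewrite ltnS => lein xG; case: grH => _ _ [coprodG _] _ _.
have [t tG xE] := coprodG i x xG.
have conv_lin := tlift_linear (conv_bilinear f a).
rewrite /= /conv_fun xE linear_fun_sum // big1 // => j _.
have [s sG ->] := tG j (ltn_ord j).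
rewrite linear_fun_sum // big_seq big1 // => p /sG[p1G p2G].
rewrite [LHS](tlift_tens (conv_bilinear f a)).
have [ltjn|lenj] := ltnP j n; first by rewrite (f0 j) ?mul0r.
rewrite (a0 (i - j)%N _ _ p2G) ?mulr0 //.
by rewrite ltnS leqn0 subn_eq0 (leq_trans lein).
Qed.

Lemma eq_graded (f g : {linear H -> A}) :
  (forall n x, x \in G n -> f x = g x) -> f = g.
Proof.
move=> fg; apply: linear_ext => x; case: grH => [[_ dec _] _ _ _ _].
have [N [c [cG ->]]] := dec x; rewrite !linear_sum.
by apply: eq_bigr => i _; apply: fg (cG i).
Qed.

(** [h] has finitely many homogeneous components; N exceeds all their degrees. *)
Lemma vanish_below_eventually (h : H) : exists N,
  forall f : {linear H -> A}, vanish_below f N -> f h = 0.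
Proof.
case: grH => [[_ dec _] _ _ _ _]; have [N [c [cG ->]]] := dec h.
exists N => f f0; rewrite linear_sum big1 // => i _.
exact: f0 (ltn_ord i) (cG i).
Qed.

Lemma degree0_lrmorphism (f : {lrmorphism H -> A}) x : x \in G 0%N ->
  f x = conv_unit hH A x.
Proof.
case: grH => _ _ _ _ G0 /G0[c ->].
by rewrite linearZ rmorph1 linearZ /= /conv_unit_fun rmorph1 scale1r.
Qed.

(** Cancelling the inverse gives gm * gamma = gp, so the argument of R is gm - gp and R kills gp. It
    remains to check gm = e + R gm degree by degree. *)
Lemma bogoliubov_recursion (Ap Am : {pred A})
    (gamma gm gp : {lrmorphism H -> A}) :
    splitting Ap Am -> projector_along Ap Am R ->
    bogoliubov hH G Ap Am gamma gm gp ->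
  (gm : B) = 1 + conv_RB ((gm : B) * (1 - (gamma : B))).
Proof.
case=> [[Ap1 _ _] _ _ _] [Rm Rp] [_ gmAm gpAp [gmV [_ gmK gammaE]]].
have gmgamma : (gm : B) * (gamma : B) = (gp : B).
  rewrite [gamma : B]gammaE; transitivity ((gm : B) * (gmV : B) * (gp : B)).
    exact: convA.
  by transitivity ((1 : B) * (gp : B)); [congr (_ * _)|exact: mul1r].
rewrite mulrBr mulr1 gmgamma; apply: eq_graded => n x xG /=.
rewrite linearB (Rp (gp x)) ?gpAp // subr0.
(* In degree 0, gm equals e and R kills the scalars, as 1 lies in [Ap]. In positive degree e
   vanishes and R fixes gm x, which lies in [Am]. *)
have [n0|n_gt0] := posnP n.
  rewrite n0 in xG; rewrite (degree0_lrmorphism _ xG).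
  by rewrite /= /conv_unit_fun [R _]linearZ /= (Rp 1) // scaler0 addr0.
rewrite /conv_unit_fun (_ : counit hH x = 0) ?scale0r ?add0r; last first.
  by case: grH => _ _ [_ counit0] _ _; apply: counit0 xG.
rewrite Rm //; apply: gmAm; exists n.+1, (fun i => if i == n then x else 0).
split=> [i|].
  case: eqP => [->//|_]; case: grH => [[/(_ i)[G0 _] _ _] _ _ _ _] //.
rewrite (big_cat_nat (n := n)) //= big_nat1 eqxx big1_seq ?add0r // => i.
by rewrite mem_index_iota => /and3P[_ _ /ltn_eqF->].
Qed.

Lemma vanish_below_iter (a f : B) n : vanish_below a 1 ->
  vanish_below (iter n (fun x : B => conv_RB (x * a)) f) n.
Proof.
move=> a0; elim: n => [//|n IH] i x ltin xG.
by rewrite /= (vanish_below_conv IH a0 ltin xG) linear0.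
Qed.

Lemma pointwise_sum_rb_iter (a x : B) :
    vanish_below a 1 -> x = 1 + conv_RB (x * a) ->
  pointwise_sum (fun n h => rb_iter conv_RB a n h)
    (fun h => x h - conv_unit hH A h).
Proof.
(* Past this N the iterates vanish at [h], and so does the remainder T^(N+1) x. *)
move=> a0 xE h; have [N N_h] := vanish_below_eventually h.
exists N; split=> [n ltNn|].
  apply: N_h => i y ltiN yG.
  exact: vanish_below_iter a0 _ _ (ltn_trans ltiN ltNn) yG.
have: (x - \sum_(0 <= k < N.+1) rb_iter conv_RB a k : B) h = 0.
  rewrite (rb_iter_remainder _ xE); apply: N_h => i y ltiN yG.
  exact: vanish_below_iter a0 _ _ (leqW ltiN) yG.
(* The term of index 0 is the convolution unit, which the target subtracts separately. *)
rewrite big_ltn // -conv_algE => rest0; apply/eqP.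
by rewrite -subr_eq0 -addrA -opprD; apply/eqP; exact: rest0.
Qed.

Lemma composition_sum_rb_iter (K0 : [pchar K] =i pred0) (a : B) n h :
    (forall x y, R x * R y = R (R x * y + x * R y - x * y)) -> (0 < n)%N ->
  composition_sum hH R a n h = rb_iter conv_RB a n h.
Proof.
move=> RR n_gt0; rewrite composition_sumE.
have K_neq0 p : (0 < p)%N -> p%:R != 0 :> K.
  by rewrite ((pcharf0P K).1 K0) -lt0n.
rewrite -(sum_comp_sum (L := fun m => conv_RB (rb_lpre conv_RB a m)) K_neq0
  (erefl _) (rb_iter_dynkin (conv_rota_baxter RR) a) (leqnn n) (ltnSn n)).
(* The empty composition, omitted from [composition_sum], contributes 0 because n > 0. *)
by rewrite [X in _ = (X : B) h]big_ltn // comp_sum0 gtn_eqF // add0r.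
Qed.

End Bogoliubov.

Lemma eq_pointwise_sum (K : fieldType) (H A : comAlgType K)
    (F F' : nat -> H -> A) s :
  (forall n h, (0 < n)%N -> F n h = F' n h) ->
  pointwise_sum F s -> pointwise_sum F' s.
Proof.
move=> FF' Fs h; have [N [F0 sE]] := Fs h; exists N; split=> [n ltNn|].
  by rewrite -FF' ?F0 // (leq_ltn_trans _ ltNn).
by rewrite sE; apply: eq_big_nat => n /andP[n_gt0 _]; apply: FF'.
Qed.

Theorem theorem9p1 (K : fieldType) (K0 : [pchar K] =i pred0)
  (H : comAlgType K) (hH : hopfAlgebra H) (G : nat -> {pred H})
  (grH : graded_connected hH G)
  (A : comAlgType K) (Ap Am : {pred A}) (splitA : splitting Ap Am)
  (R : {linear A -> A}) (projR : projector_along Ap Am R)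
  (gamma gm gp : {lrmorphism H -> A})
  (bog : bogoliubov hH G Ap Am gamma gm gp) :
  let e : {linear H -> A} := conv_unit hH A in
  let a : {linear H -> A} := e \- gamma in
  (exists2 S : H -> A,
      pointwise_sum (fun n h => RBiter hH R a n h) S
      & forall h, gm h = e h + S h) /\
  (exists2 S : H -> A,
      pointwise_sum (fun n h => composition_sum hH R a n h) S
      & forall h, gm h = e h + S h).
Proof.
move=> e a.
have aE : (a : conv_alg A hH) = 1 - (gamma : conv_alg A hH).
  exact: linear_ext.
have RR := projector_rota_baxter splitA projR.
(* By connectedness every unital algebra map agrees with the counit in degree 0, so e - gamma
   vanishes there. *)
have a0 : vanish_below G a 1.
  move=> [|//] x _ xG.
  by rewrite /= (degree0_lrmorphism grH gamma xG) subrr.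
have := bogoliubov_recursion grH splitA projR bog.
rewrite -aE => /(pointwise_sum_rb_iter grH a0) sum_gm.
(* Both series have the same sum gm - e, since their terms agree for each n > 0. *)
split; exists (fun h => gm h - e h) => [|h]; rewrite ?subrKC //.
  by apply: eq_pointwise_sum sum_gm => -[//|n] h _; rewrite RBiterE.
apply: eq_pointwise_sum sum_gm => n h n_gt0.
by rewrite composition_sum_rb_iter.
Qed.
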